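(* Let $\Omega,\mathcal{C}$ be closed, convex sets in $\mathbb{R}^d$ with nonempty interior, and $\mathcal{C}\subseteq\Omega$. Assume $f:\Omega\to\mathbb{R}$ is convex on $\mathcal{C}$, and $L$-smooth with respect to a norm $\|\cdot\|$ on $\mathcal{C}\cap\mathrm{int}(\Omega)$, for $L>0$. Assume $\phi:\Omega\to\mathbb{R}$ is of Legendre type, and $\alpha$-strongly convex with respect to $\|\cdot\|$ on $\Omega$, for $\alpha>0$. Consider the mirror descent iterates $$\theta_{t+1}=\arg\min_{\theta\in\mathcal{C}}\Big(\eta\langle\nabla f(\theta_t),\theta\rangle+D_\phi(\theta,\theta_t)\Big),\quad t=0,1,2,\dots,$$ initialized at $\theta_0\in\mathcal{C}\cap\mathrm{int}(\Omega)$, with constant step size $\eta\in(0,\alpha/L]$. Further, assume that there exists $G>0$ such that $D_\phi(z,\theta_0)\le\frac{G}{2}\|\theta_0-z\|^2$ for any $z\in\mathcal{C}$. Then for any $T\ge1$ and $\lambda_T=1/(\eta T)$, $$\min_{z\in\mathcal{C}}\Big(f(z)+\frac{\alpha\lambda_T}{4}\|\theta_0-z\|^2\Big)\le f(\theta_T)+\frac{\alpha\lambda_T}{4}\|\theta_0-\theta_T\|^2\le\min_{z\in\mathcal{C}}\Big(f(z)+\frac{(G+\alpha)\lambda_T}{2}\|\theta_0-z\|^2\Big).$$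
   Context: $\mathrm{int}(\Omega)$ is the interior of $\Omega$ (relative interior when $\Omega$ is not full-dimensional) and $\partial\Omega$ its boundary. The Bregman divergence of a convex $\phi$, differentiable on $\mathrm{int}(\Omega)$, is $D_\phi(u,v)=\phi(u)-\phi(v)-\langle\nabla\phi(v),u-v\rangle$, for $u\in\Omega$, $v\in\mathrm{int}(\Omega)$. Writing the mirror descent update presupposes that the minimizer exists. $\phi$ is of Legendre type if it is essentially smooth and essentially strictly convex. Essentially smooth: $\mathrm{int}(\Omega)\ne\emptyset$, $\phi$ is differentiable on $\mathrm{int}(\Omega)$, and $\|\nabla\phi(x_k)\|_2\to\infty$ for any sequence $\{x_k\}\subset\mathrm{int}(\Omega)$ converging to a point of $\partial\Omega$. Essentially strictly convex: strictly convex on every convex subset of $\{x\in\Omega:\partial\phi(x)\neq\emptyset\}$, where $\partial\phi(x)$ is the subdifferential. $\phi$ is $\alpha$-strongly convex with respect to $\|\cdot\|$ if $\phi(y)\ge\phi(x)+\langle\nabla\phi(x),y-x\rangle+\frac{\alpha}{2}\|x-y\|^2$ for all $y\in\Omega$ and $x\in\mathrm{int}(\Omega)$. $f$ is $L$-smooth with respect to $\|\cdot\|$ on a set if it is differentiable there and $\|\nabla f(x)-\nabla f(y)\|_*\le L\|x-y\|$ for all $x,y$ in the set, where $\|\cdot\|_*$ is the dual norm.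
   Formalization: The two minima over C are read as infima, since they need not be attained when f is not lower semicontinuous at boundary points of Ω (e.g. Ω=C=[0,∞), φ=x²/2−√x, f(x)=x for x>0, f(0)=1); where a minimum exists the two agree. *)

(* Defs.v *)
From HB Require Import structures.
From mathcomp Require Import all_boot all_order all_algebra.
From mathcomp Require Import all_classical all_reals all_analysis.

Set Implicit Arguments.
Unset Strict Implicit.
Unset Printing Implicit Defensive.

Import Order.TTheory GRing.Theory Num.Theory.
Import numFieldNormedType.Exports.

Local Open Scope classical_set_scope.
Local Open Scope ring_scope.

(* Points of R^d are row vectors 'rV[R]_d, whose
   canonical topology (sup norm) is the usual one. A function on a set Omega is
   represented by a total function; below, only its values on Omega (and its
   derivatives at interior points of Omega, which depend on nothing else) are
   used. *)

Section Euclidean.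
Context {R : realType} {d : nat}.
Implicit Types (x y u v g : 'rV[R]_d) (N : 'rV[R]_d -> R)
  (f phi : 'rV[R]_d -> R) (A C Omega S : set 'rV[R]_d).

Definition dotp u v : R := \sum_(i < d) u 0 i * v 0 i.

Definition norm2 v : R := Num.sqrt (dotp v v).

Definition gradient f x : 'rV[R]_d := \row_(i < d) 'D_(delta_mx 0 i) f x.

Definition is_norm N : Prop :=
  [/\ forall x, N x = 0 -> x = 0,
      forall (a : R) x, N (a *: x) = `|a| * N x &
      forall x y, N (x + y) <= N x + N y].

Definition dual_norm N y : R := sup [set dotp y x | x in [set x | N x <= 1]].

Definition boundary A : set 'rV[R]_d := closure A `\` interior A.

Definition bregman phi u v : R :=
  phi u - phi v - dotp (gradient phi v) (u - v).

Definition essentially_smooth Omega phi : Prop :=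
  [/\ interior Omega !=set0,
      forall x, interior Omega x -> differentiable phi x &
      forall (x_ : nat -> 'rV[R]_d) b,
        (forall k, interior Omega (x_ k)) -> boundary Omega b ->
        x_ @ \oo --> b ->
        (fun k => norm2 (gradient phi (x_ k))) @ \oo --> +oo].

(* phi is regarded as being +oo outside Omega. *)
Definition subdifferential Omega phi x : set 'rV[R]_d :=
  [set g | forall y, Omega y -> phi x + dotp g (y - x) <= phi y].

Definition strictly_convex_on S phi : Prop :=
  forall x y (t : R), S x -> S y -> x != y -> 0 < t < 1 ->
    phi (t *: x + (1 - t) *: y) < t * phi x + (1 - t) * phi y.

Definition essentially_strictly_convex Omega phi : Prop :=
  forall S, convex_set S ->
    S `<=` [set x | Omega x /\ subdifferential Omega phi x !=set0] ->
    strictly_convex_on S phi.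

Definition legendre Omega phi : Prop :=
  essentially_smooth Omega phi /\ essentially_strictly_convex Omega phi.

Definition strongly_convex N (alpha : R) Omega phi : Prop :=
  forall x y, interior Omega x -> Omega y ->
    phi y >= phi x + dotp (gradient phi x) (y - x)
             + alpha / 2 * N (x - y) ^+ 2.

Definition smooth N (L : R) A f : Prop :=
  (forall x, A x -> differentiable f x) /\
  (forall x y, A x -> A y ->
     dual_norm N (gradient f x - gradient f y) <= L * N (x - y)).

Definition is_argmin C f x : Prop :=
  C x /\ forall y, C y -> f x <= f y.

(* The minimum of f over C, taken as an infimum in the extended reals: it is the
   minimum whenever the latter is attained, and attainment may fail where f is
   not lower semicontinuous, at points of C on the boundary of the domain. *)
Definition min_over C f : \bar R := ereal_inf [set (f z)%:E | z in C].

End Euclidean.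

(* Main.v *)
Require Import Defs.
From HB Require Import structures.
From mathcomp Require Import all_boot all_order all_algebra.
From mathcomp Require Import all_classical all_reals all_analysis.
From mathcomp Require Import ring lra.

(** The left inequality holds because theta_T lies in C. The right one is the
    classical regret bound of mirror descent, combined with the squared
    triangle inequality.

    One step of the method satisfies, for every z in C,
      eta * (f theta_{t+1} - f z) <= D(z, theta_t) - D(z, theta_{t+1})
    (mirror_descent_step). Three estimates are added: the quadratic upper bound
    of the L-smooth f around theta_t (smooth_upper_bound), the tangent lower
    bound of the convex f at z (convex_gradient_le), and the variational
    inequality of the minimizer theta_{t+1} (argmin_variational), which the
    three-point identity turns into a difference of Bregman divergences. The
    error term L/2 N(theta_t - theta_{t+1})^2 of the first estimate is absorbed
    by D(theta_{t+1}, theta_t), because eta * L <= alpha. Taking z = theta_t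
    shows that f does not increase along the iterates, so the telescoped sum of
    the steps bounds T times the last gap:
      eta * T * (f theta_T - f z) <= D(z, theta_0) - D(z, theta_T).
    Finally D(z, theta_0) <= G/2 N(theta_0 - z)^2 by assumption,
    D(z, theta_T) >= alpha/2 N(theta_T - z)^2 by strong convexity, and
    N(theta_0 - theta_T)^2 <= 2 N(theta_0 - z)^2 + 2 N(theta_T - z)^2; the terms
    in N(theta_T - z)^2 cancel.

    All of this needs each iterate to be an interior point of Omega, where phi is
    differentiable. That is where essential smoothness enters (argmin_interior):
    if the minimizer b were a boundary point, the gradients of phi along the
    segment from b to a point of C interior to Omega would stay bounded, because
    the minimality of b keeps their slope along the segment from going to -oo. *)

Import Order.TTheory GRing.Theory Num.Theory.
Import numFieldNormedType.Exports.

Local Open Scope classical_set_scope.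
Local Open Scope ring_scope.

Set Implicit Arguments.
Unset Strict Implicit.

(** * Inner product *)

Lemma dotpC (R : realType) (d : nat) (u v : 'rV[R]_d) : dotp u v = dotp v u.
Proof. by apply: eq_bigr => i _; rewrite mulrC. Qed.

Lemma dotpDl (R : realType) (d : nat) (u v w : 'rV[R]_d) :
  dotp (u + v) w = dotp u w + dotp v w.
Proof. by rewrite -big_split; apply: eq_bigr => i _; rewrite mxE mulrDl. Qed.

Lemma dotpZl (R : realType) (d : nat) (a : R) (u v : 'rV[R]_d) :
  dotp (a *: u) v = a * dotp u v.
Proof. by rewrite mulr_sumr; apply: eq_bigr => i _; rewrite mxE mulrA. Qed.

Lemma dotpNl (R : realType) (d : nat) (u v : 'rV[R]_d) :
  dotp (- u) v = - dotp u v.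
Proof. by rewrite -scaleN1r dotpZl mulN1r. Qed.

Lemma dotpDr (R : realType) (d : nat) (u v w : 'rV[R]_d) :
  dotp w (u + v) = dotp w u + dotp w v.
Proof. by rewrite ![dotp w _]dotpC dotpDl. Qed.

Lemma dotpZr (R : realType) (d : nat) (a : R) (u v : 'rV[R]_d) :
  dotp v (a *: u) = a * dotp v u.
Proof. by rewrite ![dotp v _]dotpC dotpZl. Qed.

Lemma dotpNr (R : realType) (d : nat) (u v : 'rV[R]_d) :
  dotp v (- u) = - dotp v u.
Proof. by rewrite ![dotp v _]dotpC dotpNl. Qed.

Definition dotpE := (dotpDl, dotpDr, dotpNl, dotpNr, dotpZl, dotpZr).

Lemma dotp_delta (R : realType) (d : nat) (u : 'rV[R]_d) (i : 'I_d) :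
  dotp u (delta_mx 0 i) = u 0 i.
Proof.
rewrite /dotp (bigD1 i) //= mxE !eqxx mulr1 big1 ?addr0 // => j ji.
by rewrite mxE (negbTE ji) andbF mulr0.
Qed.

Lemma coord_le_norm (R : realType) (d : nat) (u : 'rV[R]_d) (i : 'I_d) :
  `|u 0 i| <= `|u|.
Proof.
rewrite [leRHS]/Num.norm /= mx_normrE; apply/bigmax_geP; right => /=.
by exists (0, i).
Qed.

Lemma dotp_le_norm (R : realType) (d : nat) (u v : 'rV[R]_d) :
  dotp u v <= (\sum_i `|u 0 i|) * `|v|.
Proof.
rewrite mulr_suml; apply: ler_sum => i _.
by rewrite (le_trans (ler_norm _))// normrM ler_wpM2l// coord_le_norm.
Qed.

(** * Gradients and one-sided slopes *)

Lemma derive_gradient (R : realType) (d : nat) (f : 'rV[R]_d -> R)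
    (x v : 'rV[R]_d) :
  differentiable f x -> 'D_v f x = dotp (gradient f x) v.
Proof.
move=> fx; rewrite deriveE // {1}(row_sum_delta v) linear_sum.
apply: eq_bigr => i _; rewrite linearZ mxE deriveE //=.
by rewrite mulrC.
Qed.

Lemma is_derive_line (R : realType) (d : nat) (f : 'rV[R]_d -> R)
    (x v : 'rV[R]_d) (s : R) :
  differentiable f (x + s *: v) ->
  is_derive s 1 (fun r : R => f (x + r *: v)) (dotp (gradient f (x + s *: v)) v).
Proof.
move=> fx.
have E : (fun h : R => h^-1 *: (((fun r : R => f (x + r *: v)) \o shift s) (h *: 1)
             - f (x + s *: v))) =
         (fun h : R => h^-1 *: ((f \o shift (x + s *: v)) (h *: v)
             - f (x + s *: v))).
  apply/funext => h /=; congr (_ *: (f _ - _)).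
  by rewrite [_ *: 1]mulr1 scalerDl addrCA.
split; first by rewrite /derivable E; exact: diff_derivable.
by rewrite -derive_gradient// /derive E.
Qed.

Lemma cvg_right_quotient (R : realType) (d : nat) (f : 'rV[R]_d -> R)
    (x v : 'rV[R]_d) : differentiable f x ->
  s^-1 * (f (x + s *: v) - f x) @[s --> 0^'+] --> dotp (gradient f x) v.
Proof.
move=> fx; rewrite -derive_gradient//.
have -> : (fun s => s^-1 * (f (x + s *: v) - f x)) =
          (fun h : R => h^-1 *: ((f \o shift x) (h *: v) - f x)).
  by apply/funext => h /=; rewrite [_ + x]addrC.
by apply: cvg_dnbhs_at_right; exact: diff_derivable.
Qed.

Lemma gradient_le_slope (R : realType) (d : nat) (f : 'rV[R]_d -> R)
    (x v : 'rV[R]_d) (c : R) : differentiable f x ->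
  (forall s, 0 < s -> s <= 1 -> f (x + s *: v) <= f x + s * c) ->
  dotp (gradient f x) v <= c.
Proof.
move=> fx fc; apply: (cvgr_to_le (@cvg_right_quotient R d f x v fx)).
near=> s.
have s0 : 0 < s by near: s; exact: nbhs_right_gt.
rewrite ler_pdivrMl// lerBlDl fc//; near: s; exact: nbhs_right_le.
Unshelve. all: by end_near. Qed.

Lemma slope_le_gradient (R : realType) (d : nat) (f : 'rV[R]_d -> R)
    (x v : 'rV[R]_d) (c : R) : differentiable f x ->
  (forall s, 0 < s -> s <= 1 -> f x + s * c <= f (x + s *: v)) ->
  c <= dotp (gradient f x) v.
Proof.
move=> fx fc; apply: (cvgr_to_ge (@cvg_right_quotient R d f x v fx)).
near=> s.
have s0 : 0 < s by near: s; exact: nbhs_right_gt.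
rewrite ler_pdivlMl// lerBrDl fc//; near: s; exact: nbhs_right_le.
Unshelve. all: by end_near. Qed.

(** * Segments in convex sets *)

Lemma convex_set_segment (R : realType) (d : nat) (A : set 'rV[R]_d)
    (x y : 'rV[R]_d) (s : R) :
  convex_set A -> A x -> A y -> 0 <= s -> s <= 1 -> A (x + s *: (y - x)).
Proof.
move=> cA Ax Ay s0 s1.
have := cA y x (@Itv01 _ s s0 s1); rewrite !inE => /(_ Ay Ax).
by rewrite [conv _ _ _]/(_ + _) /= /unstable.onem scalerBl scale1r scalerBr addrCA.
Qed.

Lemma convex_function_segment (R : realType) (d : nat) (A : set 'rV[R]_d)
    (f : 'rV[R]_d -> R) (x y : 'rV[R]_d) (s : R) :
  convex_function A f -> A x -> A y -> 0 <= s -> s <= 1 ->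
  f (x + s *: (y - x)) <= f x + s * (f y - f x).
Proof.
move=> cf Ax Ay s0 s1.
have := cf (@Itv01 _ s s0 s1) y x; rewrite !inE => /(_ Ay Ax).
rewrite [X in f X]/(_ + _) convRE /= /unstable.onem scalerBl scale1r scalerBr addrCA.
by move/le_trans; apply; rewrite mulrBl mul1r mulrBr addrCA.
Qed.

(** If the ball of radius r around x lies in A, its contraction towards b by the
    factor s is the ball of radius s * r around b + s *: (x - b), and lies in A
    by convexity. *)
Lemma interior_segment (R : realType) (d : nat) (A : set 'rV[R]_d)
    (b x : 'rV[R]_d) (s : R) :
  convex_set A -> A b -> interior A x -> 0 < s -> s <= 1 ->
  interior A (b + s *: (x - b)).
Proof.
move=> cA Ab /nbhs_ballP[r /= r0 xr] s0 s1.
apply/nbhs_ballP; exists (s * r) => /=; first by rewrite mulr_gt0.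
move=> y; rewrite -ball_normE /= => yr.
have -> : y = b + s *: ((b + s^-1 *: (y - b)) - b).
  by rewrite addrAC subrr add0r scalerA mulfV ?gt_eqF// scale1r addrC subrK.
apply: convex_set_segment => //; last exact: ltW.
apply: xr; rewrite -ball_normE /=.
rewrite -(ltr_pM2l s0) -[X in X * `|_|]gtr0_norm// -normrZ.
rewrite (le_lt_trans _ yr)// le_eqVlt; apply/orP; left; apply/eqP; congr Num.norm.
rewrite opprD addrA scalerBr scalerA mulfV ?gt_eqF// scale1r.
by rewrite opprB addrA [_ + b]addrC.
Qed.

(** * Arbitrary norms and the dual norm *)

Lemma is_norm_ge0 (R : realType) (d : nat) (N : 'rV[R]_d -> R) (x : 'rV[R]_d) :
  is_norm N -> 0 <= N x.
Proof.
case=> _ NZ ND; have := ND x (- x).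
rewrite subrr -scaleN1r -{1}(scale0r x) !NZ normr0 mul0r normrN1 mul1r.
by rewrite -mulr2n pmulrn_lge0.
Qed.

Lemma is_normN (R : realType) (d : nat) (N : 'rV[R]_d -> R) (x : 'rV[R]_d) :
  is_norm N -> N (- x) = N x.
Proof. by case=> _ NZ _; rewrite -scaleN1r NZ normrN1 mul1r. Qed.

Lemma norm_le_sup_norm (R : realType) (d : nat) (N : 'rV[R]_d -> R) :
  is_norm N ->
  exists2 K, 0 < K & forall x, N x <= K * `|x|.
Proof.
move=> Nn; have [_ NZ ND] := Nn.
exists (1 + \sum_(i < d) N (delta_mx 0 i)).
  by rewrite ltr_pwDl// sumr_ge0// => i _; exact: is_norm_ge0.
move=> x; rewrite mulrDl mul1r -[leLHS]add0r lerD//.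
have N0 : N 0 = 0 by rewrite -(scale0r 0) NZ normr0 mul0r.
rewrite {1}(row_sum_delta x) mulr_suml.
elim/big_ind2 : _ => [|u a v b ua vb|i _].
- by rewrite N0.
- by rewrite (le_trans (ND _ _))// lerD.
- by rewrite NZ mulrC ler_wpM2l ?is_norm_ge0// coord_le_norm.
Qed.

(** The topology is that of the sup norm, so this has to be derived: N is
    Lipschitz for the sup norm by norm_le_sup_norm. *)
Lemma is_norm_continuous (R : realType) (d : nat) (N : 'rV[R]_d -> R) :
  is_norm N -> continuous N.
Proof.
move=> Nn x; have [_ _ ND] := Nn; have [K K0 NK] := norm_le_sup_norm Nn.
apply/(@cvgrPdist_le _ _ _ (nbhs x)) => e e0; near=> y.
have dist u v : N u - N v <= N (u - v).
  by rewrite lerBlDr (le_trans _ (ND _ _))// subrK.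
have xy : N (x - y) <= e.
  rewrite (le_trans (NK _))// mulrC -ler_pdivlMr//.
  have : ball x (e / K) y by near: y; apply: nbhsx_ballx; rewrite divr_gt0.
  by rewrite -ball_normE => /ltW.
rewrite ler_norml lerNl opprB !(le_trans (dist _ _))//.
by rewrite -opprB is_normN.
Unshelve. all: by end_near. Qed.

(** The constant is the minimum of N over the unit sphere of the sup norm, which
    is compact. *)
Lemma sup_norm_le_norm (R : realType) (d : nat) (N : 'rV[R]_d -> R) :
  is_norm N ->
  exists2 c, 0 < c & forall x, c * `|x| <= N x.
Proof.
move=> Nn; have [Neq0 NZ _] := Nn.
pose S : set 'rV[R]_d := [set x | `|x| = 1].
have normalize (x : 'rV[R]_d) : x != 0 -> S (`|x|^-1 *: x).
  by move=> x0; rewrite /S /= normrZ normfV normr_id mulVf ?normr_eq0.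
have [S0|/set0P/negP/negPn/eqP S0] := pselect (S !=set0); last first.
  (* The sphere is empty in dimension 0, where any constant will do. *)
  exists 1 => // x; have [->|x0] := eqVneq x 0.
    by rewrite normr0 mulr0 is_norm_ge0.
  by have := normalize _ x0; rewrite S0.
have S_compact : compact S.
  apply: bounded_closed_compact.
    by exists 1; split => // M M1 x /= ->; exact: ltW.
  rewrite (_ : S = (fun x => `|x|) @^-1` [set 1])//.
  by apply: closed_comp => // x _; exact: norm_continuous.
have [c cS cmin] := EVT_min_rV S0 S_compact
  (continuous_subspaceT (@is_norm_continuous R d N Nn)).
have c0 : 0 < N c.
  rewrite lt_neqAle is_norm_ge0// andbT eq_sym; apply/eqP => /Neq0 c0.
  by move: cS; rewrite inE /S /= c0 normr0 => /esym/eqP; rewrite oner_eq0.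
exists (N c) => // x; have [->|x0] := eqVneq x 0.
  by rewrite normr0 mulr0 is_norm_ge0.
have := cmin (`|x|^-1 *: x); rewrite inE => /(_ (normalize _ x0)).
by rewrite NZ normfV normr_id mulrC ler_pdivlMr// normr_gt0.
Qed.

(** The dual norm is a real supremum, which is meaningful only for a bounded set;
    sup_norm_le_norm provides the bound. *)
Lemma dotp_le_dual_norm (R : realType) (d : nat) (N : 'rV[R]_d -> R)
    (g x : 'rV[R]_d) :
  is_norm N -> dotp g x <= dual_norm N g * N x.
Proof.
move=> Nn; have [Neq0 NZ _] := Nn.
have [/Neq0->|x0] := eqVneq (N x) 0.
  by rewrite -(scale0r 0) dotpZr NZ normr0 !mul0r mulr0.
have Nx : 0 < N x by rewrite lt_neqAle eq_sym x0 is_norm_ge0.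
rewrite -ler_pdivrMr// mulrC -dotpZr; apply: ub_le_sup; last first.
  exists ((N x)^-1 *: x) => //=.
  by rewrite NZ gtr0_norm ?invr_gt0// mulVf//; exact: lexx.
have [c c0 cN] := sup_norm_le_norm Nn.
exists ((\sum_i `|g 0 i|) * c^-1) => _ [y /= Ny <-].
rewrite (le_trans (dotp_le_norm _ _))// ler_wpM2l ?sumr_ge0//.
by rewrite -[c^-1]mulr1 ler_pdivlMl// (le_trans (cN y)).
Qed.

(** Along the segment, f minus its quadratic upper model is nonincreasing: with
    v = y - x, its derivative at s is
      <grad f (x + s v) - grad f x, v> - L s N(v)^2,
    which the Lipschitz condition on the gradient makes nonpositive. *)
Lemma smooth_upper_bound (R : realType) (d : nat) (N : 'rV[R]_d -> R) (L : R)
    (A : set 'rV[R]_d) (f : 'rV[R]_d -> R) (x y : 'rV[R]_d) :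
  is_norm N -> smooth N L A f ->
  (forall s, 0 <= s -> s <= 1 -> A (x + s *: (y - x))) ->
  f y <= f x + dotp (gradient f x) (y - x) + L / 2 * N (x - y) ^+ 2.
Proof.
move=> Nn [fdiff fLip] seg; have [_ NZ _] := Nn.
set v := y - x in seg *; set g := gradient f x.
have xA : A x by have := seg 0 (lexx _) ler01; rewrite scale0r addr0.
pose h (s : R) : R :=
  f (x + s *: v) + (- dotp g v *: s + - (L / 2 * N v ^+ 2) *: s ^+ 2).
have dh (s : R) : 0 <= s -> s <= 1 -> is_derive s 1 h
    (dotp (gradient f (x + s *: v)) v
     + (- dotp g v + - (L / 2 * N v ^+ 2) * (2 * s))).
  move=> s0 s1; apply: is_deriveD.
    by apply: is_derive_line; exact/fdiff/seg.
  apply: is_deriveD.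
    by apply: is_derive_eq; rewrite /GRing.scale /= mulr1.
  apply: is_derive_eq; rewrite /GRing.scale /= ?expr1 ?mulr1.
  by rewrite mulr_natl.
have : h 1 <= h 0.
  apply: (@ler0_derive1_nincr _ h 0 1) => //.
  - by move=> s; rewrite in_itv/= => /andP[/ltW s0 /ltW s1]; have [] := dh s s0 s1.
  - move=> s; rewrite in_itv/= => /andP[s0 /ltW s1].
    rewrite derive1E; have [_ ->] := dh s (ltW s0) s1.
    have lip := fLip _ _ (seg s (ltW s0) s1) xA.
    have := dotp_le_dual_norm (gradient f (x + s *: v) - g) v Nn.
    rewrite !dotpE => /le_trans/(_ (ler_wpM2r (is_norm_ge0 v Nn) lip)).
    have -> : x + s *: v - x = s *: v by rewrite addrAC subrr add0r.
    by rewrite NZ gtr0_norm//; nra.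
  - apply: derivable_within_continuous => s.
    by rewrite in_itv/= => /andP[s0 s1]; have [] := dh s s0 s1.
rewrite /h scale1r scale0r addr0 [x + v]addrC subrK /GRing.scale /=.
by rewrite -[x - y]opprB -/v is_normN//; nra.
Qed.

(** * Minimizers are interior points *)

(** Comparing the minimality of b with the tangent inequality of phi at
    b + s (z - b) bounds the slope of phi there from below, uniformly in s. No
    derivative at b is involved, so b may lie on the boundary of Omega. *)
Lemma argmin_first_order_along_segment (R : realType) (d : nat)
    (C Omega : set 'rV[R]_d) (phi : 'rV[R]_d -> R) (c b z : 'rV[R]_d) (s : R) :
  convex_set C -> C `<=` Omega ->
  (forall u w, interior Omega u -> Omega w ->
     phi u + dotp (gradient phi u) (w - u) <= phi w) ->
  is_argmin C (fun w => dotp c w + phi w) b -> C z ->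
  0 < s -> s <= 1 -> interior Omega (b + s *: (z - b)) ->
  - dotp c (z - b) <= dotp (gradient phi (b + s *: (z - b))) (z - b).
Proof.
move=> cC CO gradle [Cb bmin] Cz s0 s1 xO.
have := gradle _ b xO (CO _ Cb).
have := bmin _ (convex_set_segment cC Cb Cz (ltW s0) s1).
set x := b + s *: (z - b); set g := gradient phi x.
have -> : b - x = - (s *: (z - b)) by rewrite /x opprD addrA subrr add0r.
rewrite {1}/x dotpDr dotpNr !dotpZr => bx xb.
rewrite -(ler_pM2l s0); lra.
Qed.

(** Assume that b is a boundary point, and let x_k tend to b along the segment from
    b to z. The tangent inequality at x_k, evaluated at a point z + u of Omega,
    reads
      <grad phi x_k, u> <= phi (z + u) - phi x_k - (1 - s_k) <grad phi x_k, z - b>.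
    The slope term is bounded by argmin_first_order_along_segment, and phi x_k is
    bounded below by the tangent at z. Letting u be a small multiple of each
    coordinate vector, with both signs, bounds the gradients at all the x_k, which
    contradicts essential smoothness. *)
Lemma argmin_interior (R : realType) (d : nat)
    (C Omega : set 'rV[R]_d) (phi : 'rV[R]_d -> R) (c b z : 'rV[R]_d) :
  convex_set Omega -> convex_set C -> C `<=` Omega ->
  essentially_smooth Omega phi ->
  (forall u w, interior Omega u -> Omega w ->
     phi u + dotp (gradient phi u) (w - u) <= phi w) ->
  is_argmin C (fun w => dotp c w + phi w) b -> C z -> interior Omega z ->
  interior Omega b.
Proof.
move=> cO cC CO [_ _ blowup] gradle bmin Cz zO; apply: contrapT => bO.
have Cb : C b by case: bmin.
have [r /= r0 zr] : nbhs_ball z Omega by apply/nbhs_ballP.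
pose s (k : nat) : R := k.+1%:R^-1.
have s0 k : 0 < s k by rewrite invr_gt0.
have s1 k : s k <= 1 by rewrite invf_le1// ler1n.
pose x k := b + s k *: (z - b).
have xO k : interior Omega (x k).
  by apply: interior_segment => //; exact: CO.
have xb : x @ \oo --> b.
  have : b + s k *: (z - b) @[k --> \oo] --> b + 0 *: (z - b).
    apply: cvgD; first exact: cvg_cst.
    by apply: cvgZr_tmp; exact: cvg_harmonic.
  by rewrite scale0r addr0.
have bdry : boundary Omega b by split => //; exact/subset_closure/CO.
have /cvgryPge grad_oo := blowup x b xO bdry xb.
(* The constant comes from adding the tangent inequality at z to the bound of
   the slope along the segment; see low below. *)
pose M := phi z - `|dotp (gradient phi z) (z - b)| - `|dotp c (z - b)|.
have xzE k : x k - z = - ((1 - s k) *: (z - b)).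
  by rewrite /x scalerBl scale1r opprB addrAC -[b - z]opprB addrC.
have low k : M <= phi (x k) + (1 - s k) * dotp (gradient phi (x k)) (z - b).
  have := gradle z (x k) zO
    (CO _ (convex_set_segment cC Cb Cz (ltW (s0 k)) (s1 k))).
  have := argmin_first_order_along_segment cC CO gradle bmin Cz (s0 k) (s1 k)
    (xO k).
  rewrite xzE -/(x k) dotpNr dotpZr /M.
  have := ler_norm (dotp (gradient phi z) (z - b)).
  have := ler_norm (dotp c (z - b)).
  have := normr_ge0 (dotp (gradient phi z) (z - b)).
  have := normr_ge0 (dotp c (z - b)).
  move: (s0 k) (s1 k).
  nra.
pose w (a : R) (i : 'I_d) : 'rV[R]_d := z + a *: delta_mx 0 i.
have wO (a : R) i : `|a| < r -> Omega (w a i).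
  move=> ar; apply: zr; split => // j l.
  rewrite -ball_normE /= !mxE opprD addrA subrr add0r normrN normrM.
  case: (_ && _); first by rewrite normr1 mulr1.
  by rewrite normr0 mulr0.
have coord_le (a : R) i k : `|a| < r ->
    a * gradient phi (x k) 0 i <= phi (w a i) - M.
  move=> ar; have := gradle (x k) (w a i) (xO k) (wO _ _ ar).
  have -> : w a i - x k = a *: delta_mx 0 i + (1 - s k) *: (z - b).
    by rewrite -[(1 - _) *: _]opprK -xzE opprB /w addrAC addrA addrC addrA.
  by rewrite dotpDr !dotpZr dotp_delta; have := low k; lra.
pose a := r / 2.
have a0 : 0 < a by rewrite divr_gt0.
have ar : `|a| < r by rewrite gtr0_norm// /a; lra.
pose B := a^-1 * (\sum_i (`|phi (w a i)| + `|phi (w (- a) i)|) + `|M|).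
have gradB k i : `|gradient phi (x k) 0 i| <= B.
  rewrite ler_pdivlMl//.
  have : `|phi (w a i)| + `|phi (w (- a) i)| <=
         \sum_j (`|phi (w a j)| + `|phi (w (- a) j)|).
    by rewrite (bigD1 i)//= lerDl sumr_ge0// => j _; rewrite addr_ge0.
  have := coord_le a i k ar; have := coord_le (- a) i k.
  rewrite normrN => /(_ ar).
  have := ler_norm (phi (w a i)); have := ler_norm (phi (w (- a) i)).
  have := normr_ge0 (phi (w a i)); have := normr_ge0 (phi (w (- a) i)).
  have := ler_norm (- M); rewrite normrN.
  by have [_|_] := ger0P (gradient phi (x k) 0 i); lra.
pose K := \sum_(i < d) B ^+ 2.
have gradK k : dotp (gradient phi (x k)) (gradient phi (x k)) <= K.
  apply: ler_sum => i _; rewrite -expr2 -real_normK ?num_real//.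
  by rewrite lerXn2r ?nnegrE// (le_trans _ (gradB k i)).
(* Each gradient has norm at most sqrt K, which is less than 1 + K. *)
have [k _ /(_ k (leqnn k)) /= bigk] := grad_oo (1 + K).
have K0 : 0 <= K by apply: sumr_ge0 => i _; exact: sqr_ge0.
have : norm2 (gradient phi (x k)) <= Num.sqrt K by exact: ler_wsqrtr.
have := sqr_sqrtr K0; have := sqrtr_ge0 K; nra.
Qed.

(** * One mirror descent step *)

Lemma argmin_variational (R : realType) (d : nat)
    (C : set 'rV[R]_d) (phi : 'rV[R]_d -> R) (c b z : 'rV[R]_d) :
  convex_set C -> differentiable phi b ->
  is_argmin C (fun w => dotp c w + phi w) b -> C z ->
  0 <= dotp (c + gradient phi b) (z - b).
Proof.
move=> cC phib [Cb bmin] Cz.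
have : - dotp c (z - b) <= dotp (gradient phi b) (z - b).
  apply: slope_le_gradient => // s s0 s1.
  have := bmin _ (convex_set_segment cC Cb Cz (ltW s0) s1).
  by rewrite dotpDr dotpZr; lra.
by rewrite dotpDl; lra.
Qed.

Lemma convex_gradient_le (R : realType) (d : nat) (C : set 'rV[R]_d)
    (f : 'rV[R]_d -> R) (x z : 'rV[R]_d) :
  convex_function C f -> differentiable f x -> C x -> C z ->
  f x + dotp (gradient f x) (z - x) <= f z.
Proof.
move=> cf fx Cx Cz; rewrite -lerBrDl; apply: gradient_le_slope => // s s0 s1.
exact: convex_function_segment (ltW s0) s1.
Qed.

Lemma bregman_three_points (R : realType) (d : nat) (phi : 'rV[R]_d -> R)
    (z y x : 'rV[R]_d) :
  bregman phi z x - bregman phi z y - bregman phi y x =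
  dotp (gradient phi y - gradient phi x) (z - y).
Proof. by rewrite /bregman !dotpE; ring. Qed.

Lemma strongly_convex_bregman (R : realType) (d : nat) (N : 'rV[R]_d -> R)
    (alpha : R) (Omega : set 'rV[R]_d) (phi : 'rV[R]_d -> R) (x y : 'rV[R]_d) :
  strongly_convex N alpha Omega phi -> interior Omega x -> Omega y ->
  alpha / 2 * N (x - y) ^+ 2 <= bregman phi y x.
Proof. by move=> sc xO yO; have := sc x y xO yO; rewrite /bregman; lra. Qed.

(** The objective of the step is a linear function plus phi, up to a constant;
    this is the form in which the lemmas on minimizers apply. *)
Lemma mirror_step_objective (R : realType) (d : nat) (C : set 'rV[R]_d)
    (phi : 'rV[R]_d -> R) (g x y : 'rV[R]_d) (eta : R) :
  is_argmin C (fun z => eta * dotp g z + bregman phi z x) y ->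
  is_argmin C (fun z => dotp (eta *: g - gradient phi x) z + phi z) y.
Proof.
move=> [Cy ymin]; split => // z Cz; have := ymin z Cz.
by rewrite /bregman !dotpE; lra.
Qed.

(** The variational inequality at y and the three-point identity give
      eta * <grad f x, y - z> <= D(z, x) - D(z, y) - D(y, x),
    and D(y, x) >= alpha/2 N(x - y)^2 pays for the quadratic error of
    smooth_upper_bound. *)
Lemma mirror_descent_step (R : realType) (d : nat) (Omega C : set 'rV[R]_d)
    (N : 'rV[R]_d -> R) (f phi : 'rV[R]_d -> R) (L alpha eta : R)
    (x y z : 'rV[R]_d) :
  convex_set Omega -> convex_set C -> C `<=` Omega ->
  is_norm N -> convex_function C f -> 0 < L ->
  smooth N L (C `&` interior Omega) f ->
  essentially_smooth Omega phi ->
  0 < alpha -> strongly_convex N alpha Omega phi ->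
  0 < eta -> eta <= alpha / L ->
  (C `&` interior Omega) x -> interior Omega y ->
  is_argmin C (fun w => eta * dotp (gradient f x) w + bregman phi w x) y ->
  C z ->
  eta * (f y - f z) <= bregman phi z x - bregman phi z y.
Proof.
move=> cO cC CO Nn cf L0 fs [_ dphi _] alpha0 sc eta0 etaL [Cx xO] yO ymin Cz.
have Cy : C y by case: ymin.
have opt := argmin_variational cC (dphi _ yO)
  (mirror_step_objective ymin) Cz.
have three := bregman_three_points phi z y x.
have strong := strongly_convex_bregman sc xO (CO _ Cy).
have upper : f y <= f x + dotp (gradient f x) (y - x) + L / 2 * N (x - y) ^+ 2.
  apply: smooth_upper_bound Nn fs _ => s s0 s1; split.
    exact: convex_set_segment.
  have [->|s_neq0] := eqVneq s 0; first by rewrite scale0r addr0.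
  apply: interior_segment => //; first exact: CO.
  by rewrite lt_neqAle eq_sym s_neq0.
have lower := convex_gradient_le cf (fs.1 _ (conj Cx xO)) Cx Cz.
have etaL_le : eta * L <= alpha by rewrite -ler_pdivlMr.
have etaLN : eta * L * N (x - y) ^+ 2 <= alpha * N (x - y) ^+ 2.
  by rewrite ler_wpM2r// sqr_ge0.
have gap : f y - f z <= dotp (gradient f x) (y - z) + L / 2 * N (x - y) ^+ 2.
  by move: upper lower; rewrite !dotpE; lra.
have := ler_wpM2l (ltW eta0) gap.
move: opt three; rewrite !dotpE.
lra.
Qed.

Unset Implicit Arguments.
Set Strict Implicit.

(** * Convergence of mirror descent *)

Theorem corollary3 (R : realType) (d : nat) (Omega C : set 'rV[R]_d)
    (N : 'rV[R]_d -> R) (f phi : 'rV[R]_d -> R) (L alpha eta G : R)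
    (theta : nat -> 'rV[R]_d)
    (Omega_closed : closed Omega) (Omega_convex : convex_set Omega)
    (Omega_int : interior Omega !=set0)
    (C_closed : closed C) (C_convex : convex_set C)
    (C_int : interior C !=set0)
    (C_sub : C `<=` Omega)
    (N_norm : is_norm N)
    (f_convex : convex_function C f)
    (L_gt0 : 0 < L)
    (f_smooth : smooth N L (C `&` interior Omega) f)
    (phi_convex : convex_function Omega phi)
    (phi_legendre : legendre Omega phi)
    (alpha_gt0 : 0 < alpha)
    (phi_strong : strongly_convex N alpha Omega phi)
    (eta_gt0 : 0 < eta) (eta_le : eta <= alpha / L)
    (theta0 : (C `&` interior Omega) (theta 0%N))
    (theta_step : forall t : nat,
       is_argmin C
         (fun z => eta * dotp (gradient f (theta t)) z
                   + bregman phi z (theta t))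
         (theta t.+1))
    (G_gt0 : 0 < G)
    (G_bound : forall z, C z ->
       bregman phi z (theta 0%N) <= G / 2 * N (theta 0%N - z) ^+ 2)
    (T : nat) (T_ge1 : (1 <= T)%N) :
  let lambda := 1 / (eta * T%:R) in
  let lhs := min_over C
    (fun z => f z + alpha * lambda / 4 * N (theta 0%N - z) ^+ 2) in
  let mid := f (theta T)
    + alpha * lambda / 4 * N (theta 0%N - theta T) ^+ 2 in
  let rhs := min_over C
    (fun z => f z + (G + alpha) * lambda / 2 * N (theta 0%N - z) ^+ 2) in
  (lhs <= mid%:E)%E /\ (mid%:E <= rhs)%E.
Proof.
move=> lambda lhs mid rhs.
have gradle u w : interior Omega u -> Omega w ->
    phi u + dotp (gradient phi u) (w - u) <= phi w.
  move=> uO wO; apply: le_trans (phi_strong u w uO wO).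
  by rewrite lerDl mulr_ge0 ?sqr_ge0// divr_ge0// ltW.
have thetaP t : (C `&` interior Omega) (theta t).
  elim: t => [|t [Ct tO]]; first exact: theta0.
  have thetaS := mirror_step_objective (theta_step t).
  split; first by case: thetaS.
  exact: (argmin_interior Omega_convex C_convex C_sub
    phi_legendre.1 gradle thetaS Ct tO).
have step t z : C z -> eta * (f (theta t.+1) - f z) <=
    bregman phi z (theta t) - bregman phi z (theta t.+1).
  move=> Cz; exact: (mirror_descent_step
    Omega_convex C_convex C_sub N_norm f_convex L_gt0 f_smooth
    phi_legendre.1 alpha_gt0 phi_strong eta_gt0 eta_le
    (thetaP t) (thetaP t.+1).2 (theta_step t) Cz).
have descent t : f (theta t.+1) <= f (theta t).
  have := step t _ (thetaP t).1.
  have [CSt SO] := thetaP t.+1; have [Ct tO] := thetaP t.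
  have := strongly_convex_bregman phi_strong SO (C_sub _ Ct).
  have : 0 <= alpha / 2 * N (theta t.+1 - theta t) ^+ 2.
    by rewrite mulr_ge0 ?sqr_ge0// divr_ge0// ltW.
  have -> : bregman phi (theta t) (theta t) = 0.
    by rewrite /bregman !dotpE; ring.
  by move=> h1 h2 h3; rewrite -subr_le0 -(pmulr_rle0 _ eta_gt0); lra.
(* By monotonicity the earlier gaps may be replaced by the current one. *)
have regret t z : C z -> eta * t%:R * (f (theta t) - f z) <=
    bregman phi z (theta 0%N) - bregman phi z (theta t).
  move=> Cz; elim: t => [|t IH]; first by rewrite mulr0 mul0r subrr.
  have := step t z Cz.
  have : eta * t%:R * (f (theta t.+1) - f z) <= eta * t%:R * (f (theta t) - f z).
    by rewrite ler_wpM2l ?lerD2r// mulr_ge0// ltW.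
  by rewrite -[t.+1%:R]natr1; lra.
have [CT TO] := thetaP T.
split; first by apply: ereal_inf_lbound; exists (theta T).
apply: le_ereal_inf_tmp => _ [z Cz <-]; rewrite lee_fin /mid.
have T0 : 0 < eta * T%:R by rewrite mulr_gt0// ltr0n.
have lambda0 : 0 < lambda by rewrite divr_gt0.
have gap : f (theta T) - f z <=
    lambda * (bregman phi z (theta 0%N) - bregman phi z (theta T)).
  by rewrite /lambda mulrAC mul1r ler_pdivlMr// mulrC regret.
have lower := strongly_convex_bregman phi_strong TO (C_sub _ Cz).
have upper := G_bound z Cz.
have square_triangle : N (theta 0%N - theta T) ^+ 2 <=
    2 * N (theta 0%N - z) ^+ 2 + 2 * N (theta T - z) ^+ 2.
  have [_ _ ND] := N_norm.
  have := ND (theta 0%N - z) (z - theta T).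
  rewrite addrA subrK -[z - theta T]opprB is_normN//.
  have := is_norm_ge0 (theta 0%N - theta T) N_norm.
  by have := sqr_ge0 (N (theta 0%N - z) - N (theta T - z)); nra.
have weighted : lambda * (bregman phi z (theta 0%N) - bregman phi z (theta T)) <=
    lambda * (G / 2 * N (theta 0%N - z) ^+ 2 - alpha / 2 * N (theta T - z) ^+ 2).
  by apply: (ler_wpM2l (ltW lambda0)); exact: lerB.
have := ler_wpM2l (ltW (mulr_gt0 alpha_gt0 lambda0)) square_triangle.
lra.
Qed.
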